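(* For every integer $n \ge 3$: $\phi_{2n}(4) = v(n)$ if $v(n) \equiv 1 \pmod 4$ or $v(n) = 2$, and $\phi_{2n}(4) = -v(n)$ if $v(n) \equiv -1 \pmod 4$.
   Context: For an integer $m \ge 3$, let $\phi_m(x) \in \mathbb{Z}[x]$ denote the minimal polynomial of $4\sin^2\left(\frac{\pi}{m}\right)$, normalized (up to sign) so that its constant term is positive; equivalently, $\phi_m(x) = \prod_{0 < j < \frac{m}{2},\ \gcd(j,m)=1} \left(4\sin^2\left(\frac{j\pi}{m}\right) - x\right)$. For an integer $n > 1$, define $v(n) = p$ if $n = p^k$ is a power ($k \ge 1$) of a prime $p$, and $v(n) = 1$ otherwise. *)

(* Defs.v *)
From HB Require Import structures.
From mathcomp Require Import all_boot all_order all_algebra.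
From mathcomp Require Import all_classical all_reals all_analysis.

Set Implicit Arguments.
Unset Strict Implicit.
Unset Printing Implicit Defensive.

Import Order.TTheory GRing.Theory Num.Theory.

Local Open Scope classical_set_scope.
Local Open Scope ring_scope.

(* [q] is the monic generator of the ideal of the rational polynomials that
   vanish at [a]; compare [minCpolyP] for algebraic complex numbers. *)
Definition is_minpoly (R : realType) (a : R) (q : {poly rat}) : Prop :=
  q \is monic /\ forall r : {poly rat}, root (map_poly ratr r) a = (q %| r).

Definition is_phi (R : realType) (m : nat) (p : {poly int}) : Prop :=
  (exists2 q : {poly rat}, is_minpoly (4 * sin (pi / m%:R : R) ^+ 2) q &
     map_poly intr p = q \/ map_poly intr p = - q)
  /\ 0 < p`_0.

Lemma is_phi_unique (R : realType) (m : nat) (p1 p2 : {poly int}) :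
  is_phi R m p1 -> is_phi R m p2 -> p1 = p2.
Proof.
move=> [[q1 [mq1 hq1] e1] c1] [[q2 [mq2 hq2] e2] c2].
have q12 : q1 = q2.
  apply/eqP; rewrite -eqp_monic// /eqp -hq1 hq2 dvdpp /=.
  by rewrite -hq2 hq1 dvdpp.
subst q2; have inj : injective (map_poly (intr : int -> rat)).
  by apply: map_inj_poly => //; exact: intr_inj.
have D : p1 = p2 \/ p1 = - p2.
  case: e1 => e1; case: e2 => e2; [left|right|right|left];
    by apply: inj; rewrite ?rmorphN /= e1 e2 ?opprK.
case: D => // D; move: c1; rewrite D coefN oppr_gt0 => c1.
by have := lt_trans c1 c2; rewrite ltxx.
Qed.

(* [phi R m] is the unique [p] such that [is_phi R m p]; the default value 0 is
   taken when there is none. *)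
Definition phi (R : realType) (m : nat) : {poly int} :=
  xget 0 [set p | is_phi R m p].

(* At most one [p] satisfies the condition; 1 is the value when there is none. *)
Definition v (n : nat) : nat :=
  xget 1%N [set p : nat | prime p /\ exists2 k : nat, (0 < k)%N & n = (p ^ k)%N].

(* Main.v *)
(* Put [m = 2 n] and let [z] be a primitive [m]-th root of unity. The cyclotomic
   polynomial ['Phi_m] is palindromic of even degree [2 k], hence
   ['Phi_m(X) = X ^ k psi(2 - X - X^-1)] for an integer polynomial [psi] of
   degree [k]. A rational polynomial of degree [e] vanishing at
   [2 - z - z^-1 = 4 sin(pi / m) ^ 2] yields one of degree [2 e] vanishing at
   [z], so [e >= k] and [psi] is, up to sign, the minimal polynomial. Evaluation at
   [X = -1] and [X = 1] gives [psi(4) = (-1) ^ k 'Phi_m(-1) = (-1) ^ k v(n)] and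
   [psi(0) = 'Phi_m(1) = v(m)]. If [v(n) <> 2] then [v(m) = 1], and the sign
   follows from [psi(4) = psi(0) = 1 (mod 4)]; if [v(n) = 2] then [n] is a power
   of 2 and [k] is even. *)
Require Import Defs.
From mathcomp Require Import all_boot all_order all_algebra.
From mathcomp Require Import all_classical all_reals all_analysis.
From mathcomp Require Import algC cyclotomic complex ring.

Import Order.TTheory GRing.Theory Num.Theory.

Local Open Scope ring_scope.

(** * The function [v] and its products over divisors *)

Lemma v_primeX (p k : nat) : prime p -> (0 < k)%N -> v (p ^ k) = p.
Proof.
move=> p_pr k_gt0; rewrite /v.
case: xgetP => [q -> [q_pr [j j_gt0 /(congr1 primes)]]|/(_ p) []]; last first.
  by split=> //; exists k.
by rewrite !primesX // !primes_prime // => -[].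
Qed.

Lemma vP (n : nat) :
  v n = 1%N \/ prime (v n) /\ exists2 k, (0 < k)%N & n = (v n ^ k)%N.
Proof. by rewrite /v; case: xgetP => [q -> [? ?]|_]; [right|left]. Qed.

Lemma v_gt0 (n : nat) : (0 < v n)%N.
Proof. by case: (vP n) => [->|[/prime_gt0]]. Qed.

(** Strong induction from [n %/ p] to [n], where [p] is the least prime factor of [n]: among the
    divisors that do not divide [n %/ p], only the [p]-part of [n] contributes a nontrivial factor,
    namely [p]. *)
Lemma prod_v_divisors (n : nat) :
  (0 < n)%N -> (\prod_(d <- divisors n | d != 1) v d)%N = n.
Proof.
elim/ltn_ind: n => n IHn n_gt0.
have [->|n_gt1] : n = 1%N \/ (1 < n)%N by case: n n_gt0 {IHn} => [|[]]; auto.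
  by rewrite big_cons big_nil.
set p := pdiv n; have p_pr : prime p by exact: pdiv_prime.
have pn : (p %| n)%N by exact: pdiv_dvd.
have p_gt1 := prime_gt1 p_pr.
have m_gt0 : (0 < n %/ p)%N by rewrite divn_gt0 ?prime_gt0 // dvdn_leq.
have m_lt : (n %/ p < n)%N by rewrite ltn_Pdiv.
have e_gt0 : (0 < logn p n)%N by rewrite logn_gt0 mem_primes p_pr n_gt0.
rewrite (bigID (fun d => d %| n %/ p)%N) /=.
have -> : (\prod_(d <- divisors n | (d != 1) && (d %| n %/ p)) v d)%N
    = (n %/ p)%N.
  rewrite -[RHS]IHn //; under eq_bigl do rewrite andbC.
  rewrite -big_filter_cond; apply: perm_big; apply: uniq_perm.
  - exact/filter_uniq/divisors_uniq.
  - exact: divisors_uniq.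
  move=> d; rewrite mem_filter -!dvdn_divisors //.
  by apply: andb_idr => /dvdn_trans; apply; rewrite dvdn_div.
suff -> : (\prod_(d <- divisors n | (d != 1) && ~~ (d %| n %/ p)) v d)%N = p.
  by rewrite divnK.
have logm : logn p (n %/ p) = (logn p n).-1.
  by rewrite logn_div // (pfactorK 1 p_pr) subn1.
have pe_gt1 : (1 < p ^ logn p n)%N by rewrite -(expn0 p) ltn_exp2l.
(* A divisor of [n] that does not divide [n %/ p] is a multiple of the full
   [p]-part of [n], so it is a prime power only if it is this [p]-part. *)
rewrite -big_filter (bigD1_seq (p ^ logn p n)%N) /=; last 2 first.
- rewrite mem_filter -dvdn_divisors // pfactor_dvdnn andbT gtn_eqF //=.
  by rewrite pfactor_dvdn // logm -ltnNge prednK.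
- exact/filter_uniq/divisors_uniq.
rewrite v_primeX // big_seq_cond big1 ?muln1 // => d.
rewrite mem_filter -dvdn_divisors // => /andP[/andP[/andP[_ dNm] dn] dNpe].
have d_gt0 : (0 < d)%N := dvdn_gt0 n_gt0 dn.
have [//|[q_pr [k k_gt0 d_eq]]] := vP d.
case/negP: dNm; have [q_eq|q_neq] := eqVneq (v d) p.
  rewrite q_eq in d_eq; rewrite d_eq pfactor_dvdn // logm -ltnS prednK //.
  rewrite ltn_neqAle -pfactor_dvdn // -d_eq dn andbT.
  by apply: contra dNpe => /eqP <-; rewrite -d_eq.
rewrite -(Gauss_dvdl _ (_ : coprime d p)) ?divnK //.
rewrite d_eq coprime_pexpl // prime_coprime // dvdn_prime2 //.
Qed.

(* [v] is the exponential of the von Mangoldt function; the lemma is applied to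
   both [d |-> 'Phi_d.[1]] and [d |-> 'Phi_(2 d).[-1]]. *)
Lemma v_unique (f : nat -> int) :
  (forall n, (0 < n)%N -> \prod_(d <- divisors n | d != 1%N) f d = n%:Z) ->
  forall n, (1 < n)%N -> f n = (v n)%:Z.
Proof.
move=> fP; elim/ltn_ind=> n IHn n_gt1; have n_gt0 : (0 < n)%N by exact: ltnW.
set r := [seq d <- divisors n | d != 1%N].
have r_uniq : uniq r by exact/filter_uniq/divisors_uniq.
have r_n : n \in r by rewrite mem_filter gtn_eqF // -dvdn_divisors /=.
have fr : \prod_(d <- r) f d = n%:Z by rewrite big_filter fP.
have vr : \prod_(d <- r) (v d)%:Z = n%:Z.
  rewrite -(big_morph Posz PoszM (erefl (Posz 1))) big_filter.
  by rewrite prod_v_divisors.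
(* By induction both products agree away from [n]; this common part is nonzero and cancels. *)
move: fr; rewrite -vr !(bigD1_seq n) //= => fv.
have tl : \prod_(d <- r | d != n) f d = \prod_(d <- r | d != n) (v d)%:Z.
  rewrite big_seq_cond [RHS]big_seq_cond; apply: eq_bigr => d.
  rewrite mem_filter -dvdn_divisors // => /andP[/andP[d1 dn] d_neq].
  apply/IHn; first by rewrite ltn_neqAle d_neq dvdn_leq.
  by rewrite ltn_neqAle eq_sym d1 (dvdn_gt0 n_gt0 dn).
rewrite tl in fv; apply: mulIf fv.
rewrite prodf_seq_neq0; apply/allP => d _.
by apply/implyP => _; case: (v d) (v_gt0 d).
Qed.

(** * Cyclotomic polynomials at 1 and -1 *)

Lemma Cyclotomic1 : 'Phi_1 = 'X - 1 :> {poly int}.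
Proof. by have := @prod_Cyclotomic 1 isT; rewrite big_cons big_nil mulr1. Qed.

Lemma Cyclotomic2 : 'Phi_2 = 'X + 1 :> {poly int}.
Proof.
have := @prod_Cyclotomic 2 isT; rewrite !big_cons big_nil mulr1 Cyclotomic1.
rewrite -(expr1n _ 2) subr_sqr expr1n; apply: mulfI.
by rewrite -polyC1 polyXsubC_eq0.
Qed.

(** Cancelling ['Phi_1] in the factorization of ['X^n - 1] leaves the geometric sum, whose value at
    1 is [n]; this is the hypothesis of [v_unique]. *)
Lemma Cyclotomic_at1 (n : nat) : (1 < n)%N -> ('Phi_n).[1] = (v n)%:Z.
Proof.
apply: (v_unique (fun d => ('Phi_d).[1])) => {}n n_gt0.
rewrite -horner_prod.
have /mulfI : ('X - 1 : {poly int}) != 0 by rewrite -polyC1 polyXsubC_eq0.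
move=> /(_ (\prod_(d <- divisors n | d != 1%N) 'Phi_d) (\sum_(i < n) 'X^i)) ->.
  rewrite horner_sum (eq_bigr (fun=> 1)) => [|i _]; last first.
    by rewrite hornerXn expr1n.
  by rewrite sumr_const card_ord natz.
rewrite -subrX1 -prod_Cyclotomic //.
rewrite (bigD1_seq 1%N) ?divisors_uniq ?divisor1 //=.
by rewrite Cyclotomic1.
Qed.

(** With [m] the odd part of [n], cancelling ['X + 1] in the factorization of ['X^(2 * n) - 1] gives
    [A * ('X^m - 1) = ('X - 1) * \sum_(i < n) 'X^2 ^+ i]. At -1 this reads [-2 A(-1) = -2 n]. *)
Lemma Cyclotomic_double_atN1 (n : nat) :
  (1 < n)%N -> ('Phi_(2 * n)).[-1] = (v n)%:Z.
Proof.
apply: (v_unique (fun d => ('Phi_(2 * d)).[-1])) => {}n n_gt0.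
rewrite -horner_prod.
set m := (n`_2^')%N; have m_gt0 : (0 < m)%N by exact: part_gt0.
have m_odd : odd m by rewrite -[odd _]negbK -dvdn2 -p'natE // part_pnat.
have n2_gt0 : (0 < 2 * n)%N by rewrite muln_gt0.
set A := \prod_(_ <- _ | _) _.
(* The even divisors of [2 n] are the [2 d] with [d | n], and the odd ones are
   the divisors of [m]. *)
have fact : ('X + 1) * A * ('X^m - 1) = 'X^(2 * n) - 1 :> {poly int}.
  rewrite -Cyclotomic2 -!prod_Cyclotomic // [RHS](bigID (dvdn 2)) /=.
  congr (_ * _).
    have -> : 'Phi_2 * A = \prod_(d <- divisors n) 'Phi_(2 * d).
      by rewrite [RHS](bigD1_seq 1%N) ?divisors_uniq ?divisor1.
    rewrite -(big_map (muln 2) xpredT (fun d => 'Phi_d)) -[RHS]big_filter.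
    apply: perm_big; apply: uniq_perm.
    - rewrite map_inj_uniq ?divisors_uniq // => i j /eqP.
      by rewrite eqn_pmul2l // => /eqP.
    - exact/filter_uniq/divisors_uniq.
    move=> d; rewrite mem_filter -dvdn_divisors //.
    apply/mapP/andP => [[e]|[/dvdnP[e ->]]].
      by rewrite -dvdn_divisors // => en ->; rewrite dvdn_mulr // dvdn_pmul2l.
    by rewrite mulnC dvdn_pmul2l // => en; exists e => //;
    rewrite -dvdn_divisors.
  rewrite -[RHS]big_filter; apply: perm_big; apply: uniq_perm.
  - exact: divisors_uniq.
  - exact/filter_uniq/divisors_uniq.
  move=> d; rewrite mem_filter -!dvdn_divisors // dvdn2 negbK.
  apply/idP/andP => [dm|[d_odd d2n]].
    rewrite (dvdn_odd dm) //; split=> //.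
    exact/dvdn_mull/(dvdn_trans dm)/dvdn_part.
  have dn : (d %| n)%N by rewrite -(@Gauss_dvdr d 2) // coprime_sym coprime2n.
  have : (d`_2^' %| m)%N by exact: partn_dvd.
  by rewrite part_pnat_id // p'natE ?dvdn2 ?negbK // (dvdn_gt0 n_gt0 dn).
have /mulfI/(_ (A * ('X^m - 1)) (('X - 1) * \sum_(i < n) 'X^2 ^+ i)) :
    ('X + 1 : {poly int}) != 0.
  by rewrite -[1]opprK -polyC1 -polyCN polyXsubC_eq0.
rewrite mulrA fact mulrA [_ * ('X - 1)]mulrC -subr_sqr expr1n -subrX1 -exprM.
move=> /(_ erefl) /(congr1 (fun p => p.[-1])).
rewrite !(hornerD, hornerN, hornerM, hornerXn, hornerX, hornerC) horner_sum.
under eq_bigr do rewrite -exprM hornerXn exprM sqrrN !expr1n.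
rewrite sumr_const card_ord natz -signr_odd m_odd expr1 -opprD mulrC.
exact: mulfI.
Qed.

(** * Palindromic polynomials as polynomials in [2 - X - X^-1] *)

(* [symmetrize k q] is [X ^ k q(2 - X - X^-1)], since
   [2 - X - X^-1 = - (X - 1) ^ 2 / X]. *)
Definition symmetrize {R : nzRingType} (k : nat) (q : {poly R}) : {poly R} :=
  \sum_(i < k.+1) q`_i *: ((- ('X - 1) ^+ 2) ^+ i * 'X^(k - i)).

Lemma horner_symmetrize {R : comUnitRingType} (k : nat) (q : {poly R}) (x : R) :
  (size q <= k.+1)%N -> x \is a GRing.unit ->
  (symmetrize k q).[x] = x ^+ k * q.[2 - x - x^-1].
Proof.
move=> q_size x_unit; rewrite (horner_coef_wide _ q_size) mulr_sumr horner_sum.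
apply: eq_bigr => i _.
rewrite !(hornerZ, hornerM, horner_exp, hornerN, hornerD, hornerX, hornerC).
have -> : - (x - 1) ^+ 2 = x * (2 - x - x^-1).
  by rewrite !mulrBr divrr //; ring.
have ik : (i <= k)%N by rewrite -ltnS.
have -> : x ^+ k = x ^+ i * x ^+ (k - i) by rewrite -exprD subnKC.
by rewrite exprMn; ring.
Qed.

(** All terms but the last contain a factor ['X]. The value at 0 thus reads off the top coefficient
    of [q]. *)
Lemma symmetrize_at0 {R : comNzRingType} (k : nat) (q : {poly R}) :
  (symmetrize k q).[0] = (-1) ^+ k * q`_k.
Proof.
rewrite horner_sum big_ord_recr big1 /= => [|i _].
  rewrite add0r subnn.
  rewrite !(hornerZ, hornerM, horner_exp, hornerN, hornerD, hornerX, hornerC).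
  have -> : - (0 - 1) ^+ 2 = -1 :> R by ring.
  by rewrite mulr1 mulrC.
rewrite !(hornerZ, hornerM, horner_exp, hornerX).
by rewrite expr0n subn_eq0 leqNgt ltn_ord !mulr0.
Qed.

Lemma size_symmetrize {R : nzRingType} (k : nat) (q : {poly R}) :
  (size (symmetrize k q) <= (2 * k).+1)%N.
Proof.
apply: (leq_trans (size_sum _ _ _)); apply/bigmax_leqP => i _.
apply: (leq_trans (size_scale_leq _ _)).
apply: (leq_trans (size_polyMleq _ _)); rewrite size_polyXn addnS /=.
have ik : (i <= k)%N by rewrite -ltnS.
apply: (@leq_trans ((2 * i).+1 + (k - i))%N); last first.
  by rewrite addSn ltnS !mul2n -!addnn -addnA subnKC // leq_add2r.
rewrite leq_add2r; apply: (leq_trans (size_poly_exp_leq _ _)).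
rewrite ltnS leq_mul2r size_polyN; apply/orP; right.
have /= := size_poly_exp_leq ('X - 1 : {poly R}) 2.
rewrite -polyC1 size_XsubC; by case: (size _).
Qed.

Lemma map_symmetrize {R S : nzRingType} (f : {rmorphism R -> S}) (k : nat)
    (q : {poly R}) :
  map_poly f (symmetrize k q) = symmetrize k (map_poly f q).
Proof.
rewrite rmorph_sum; apply: eq_bigr => i _ /=.
rewrite map_polyZ rmorphM !rmorphXn /= rmorphN rmorphXn rmorphB /=.
by rewrite rmorph1 map_polyX coef_map.
Qed.

Lemma symmetrizeS {R : nzRingType} (k : nat) (q : {poly R}) :
  symmetrize k.+1 q
  = symmetrize k q * 'X + q`_k.+1 *: (- ('X - 1) ^+ 2) ^+ k.+1.
Proof.
rewrite /symmetrize big_ord_recr /= subnn mulr1; congr (_ + _).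
rewrite mulr_suml; apply: eq_bigr => i _.
by rewrite -scalerAl -mulrA -exprSr subSn // -ltnS.
Qed.

Lemma eq_symmetrize {R : nzRingType} (k : nat) (p q : {poly R}) :
  (forall i, (i <= k)%N -> p`_i = q`_i) -> symmetrize k p = symmetrize k q.
Proof. by move=> pq; apply: eq_bigr => i _; rewrite pq // -ltnS. Qed.

(** Induction on [k]: subtracting the multiple of the palindrome [('X - 1) ^+ (2 * k.+1)] that kills
    the constant coefficient also kills the top one, and dividing by ['X] leaves a palindrome for
    [k]. *)
Lemma palindrome_symmetrize {R : comNzRingType} (k : nat) (p : {poly R}) :
  (size p <= (2 * k).+1)%N ->
  (forall i, (i <= 2 * k)%N -> p`_i = p`_(2 * k - i)) ->
  exists2 q : {poly R}, (size q <= k.+1)%N & p = symmetrize k q.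
Proof.
elim: k p => [|k IHk] p p_size pP.
  exists p => //; rewrite /symmetrize big_ord1 expr0 mulr1 alg_polyC.
  exact: size1_polyC.
pose b : {poly R} := \poly_(i < (2 * k.+1).+1) ((-1) ^+ i *+ 'C(2 * k.+1, i)).
have bE : b = (('X - 1) ^+ 2) ^+ k.+1.
  rewrite -sqrrN opprB -exprM exprBn /b poly_def; apply: eq_bigr => i _.
  by rewrite expr1n mulr1 -mul_polyC rmorphMn rmorphXn rmorphN1 mulrnAl.
pose r := p - p`_0 *: b.
have r0 : r`_0 = 0 by rewrite !coefE /= bin0 mulr1 subrr.
have rP i : (i <= 2 * k.+1)%N -> r`_i = r`_(2 * k.+1 - i).
  move=> ik; rewrite !coefB !coefZ !coef_poly !ltnS ik leq_subr -pP //.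
  rewrite bin_sub // -(signr_odd _ (_ - _)) oddB // mul2n odd_double.
  by rewrite signr_odd.
pose s := \poly_(i < (2 * k).+1) r`_i.+1.
have r_max i : (2 * k < i)%N -> r`_i.+1 = 0.
  rewrite leq_eqVlt => /predU1P[<-|ki].
    by rewrite -[_.+2](mulnS 2) rP ?subnn ?r0.
  rewrite /r coefB coefZ coef_poly mulnS !ltnS leqNgt ki mulr0 subr0
    nth_default //.
  by apply: leq_trans p_size _; rewrite mulnS.
have rE : r = s * 'X.
  apply/polyP => -[|i]; rewrite coefMX //= coef_poly ltnS.
  by case: leqP => // /r_max.
have [||q q_size sE] := IHk s; first exact: size_poly.
  move=> i ik; rewrite !coef_poly !ltnS ik leq_subr rP.
    by rewrite mulnS subSS -subSn.
  by rewrite mulnS ltnS (leq_trans ik).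
(* The sign compensates for [symmetrize] using powers of [- ('X - 1) ^+ 2]. *)
exists (q + ((-1) ^+ k.+1 * p`_0) *: 'X^(k.+1)).
  apply: (leq_trans (size_polyD _ _)); rewrite geq_max (leqW q_size) /=.
  by apply: (leq_trans (size_scale_leq _ _)); rewrite size_polyXn.
rewrite symmetrizeS (eq_symmetrize _ _ q) => [|i ik]; last first.
  by rewrite coefD coefZ coefXn ltn_eqF ?mulr0 ?addr0.
rewrite -sE -rE coefD coefZ coefXn eqxx nth_default // add0r mulr1.
rewrite [(- _ ^+ 2) ^+ _]exprNn -bE.
have -> : (-1) ^+ k.+1 * b = (-1) ^+ k.+1 *: b.
  by rewrite -[in RHS]mul_polyC rmorphXn rmorphN1.
by rewrite scalerA mulrAC -expr2 sqrr_sign mul1r subrK.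
Qed.

(** * Roots, irreducibility and symmetry of cyclotomic polynomials *)

(** As a root of ['X^n - 1], [x] is a root of ['Phi_d] for some divisor [d] of [n]; then
    [x ^+ d = 1], and primitivity forces [d = n]. *)
Lemma root_Cyclotomic (F : numFieldType) (n : nat) (x : F) :
  n.-primitive_root x -> root (map_poly intr 'Phi_n) x.
Proof.
move=> x_prim; have n_gt0 := prim_order_gt0 x_prim.
have : root (map_poly intr ('X^n - 1)) x.
  rewrite rmorphB rmorph1 /= map_polyXn -[root _ _]/(n.-unity_root x).
  by rewrite unity_rootE (prim_expr_order x_prim) eqxx.
rewrite -prod_Cyclotomic // rmorph_prod /root /= horner_prod prodf_seq_eq0.
case/hasP => d dn d_root; suff -> : n = d by [].
move: dn; rewrite -dvdn_divisors // => dn; apply/eqP; rewrite eqn_dvd dn andbT.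
have d_gt0 := dvdn_gt0 n_gt0 dn.
rewrite (prim_order_dvd x_prim) -subr_eq0.
have := congr1 (fun p : {poly int} => (map_poly intr p : {poly F}).[x])
  (prod_Cyclotomic d_gt0).
rewrite rmorphB rmorph1 /= map_polyXn !hornerE => <-.
rewrite rmorph_prod horner_prod prodf_seq_eq0; apply/hasP; exists d => //.
by rewrite -dvdn_divisors.
Qed.

(* The library has this only for roots of unity in [algC]; irreducibility of
   ['Phi_n] transfers it to [F]. *)
Lemma Cyclotomic_dvdp (F : numFieldType) (n : nat) (x : F) (q : {poly rat}) :
  n.-primitive_root x -> root (map_poly ratr q) x -> map_poly intr 'Phi_n %| q.
Proof.
move=> x_prim qx; have n_gt0 := prim_order_gt0 x_prim.
have [z z_prim] := C_prim_root_exists n_gt0.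
set P : {poly rat} := map_poly intr 'Phi_n.
have PE (K : numFieldType) : map_poly ratr P = map_poly intr 'Phi_n :> {poly K}.
  by rewrite -map_poly_comp; apply: eq_map_poly => c; rewrite /= ratr_int.
have zP r : root (map_poly ratr r) z = (P %| r).
  have [p [pz _] ->] := minCpolyP z; suff -> : P = p by [].
  apply: (@map_poly_inj _ algC ratr); rewrite -pz PE.
  by rewrite (Cintr_Cyclotomic z_prim) (minCpoly_cyclotomic z_prim).
have g_root : root (map_poly ratr (gcdp P q)) x.
  by rewrite gcdp_map root_gcd PE root_Cyclotomic.
have P_neq0 : P != 0 by rewrite monic_neq0 ?monic_map ?Cyclotomic_monic.
have /dvdpP[s Ps] := dvdp_gcdl P q.
have : root (map_poly ratr P) z by rewrite zP.
(* If [z] is a root of the gcd, then [P] divides the gcd and hence [q]. Otherwise [P] divides the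
   cofactor [s], so the gcd is constant, although it vanishes at [x]. *)
rewrite {1}Ps rmorphM rootM !zP => /orP[Ps'|/dvdp_trans->//];
last exact: dvdp_gcdr.
have /andP[s_neq0 g_neq0] : (s != 0) && (gcdp P q != 0).
  by rewrite -negb_or -mulf_eq0 -Ps.
have := dvdp_leq s_neq0 Ps'.
rewrite {1}Ps size_mul //; have := root_size_gt1 _ g_root.
rewrite map_poly_eq0 size_map_poly => /(_ g_neq0).
case: (size (gcdp P q)) => [|[|m]] // _; by rewrite !addnS /= ltnNge leq_addr.
Qed.

(** The inverse of a primitive root is primitive, so ['Phi_n] divides its own reversal and, by size,
    is proportional to it. Both take the same nonzero value [v n] at 1, so the ratio is 1. For
    [n = 1] that value is 0 and ['X - 1] is antisymmetric. *)
Lemma Cyclotomic_palindrome (n i : nat) : (1 < n)%N -> (i <= totient n)%N ->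
  ('Phi_n)`_i = ('Phi_n)`_(totient n - i).
Proof.
move=> n_gt1 i_le; have n_gt0 := ltnW n_gt1.
pose P : {poly rat} := map_poly intr 'Phi_n.
have P_size : size P = (totient n).+1.
  by rewrite size_map_poly_id0 ?size_Cyclotomic // (monicP (Cyclotomic_monic
    n)).
pose rev := \poly_(j < (totient n).+1) P`_(totient n - j).
have rev1 : rev.[1] = P.[1].
  rewrite (@horner_coef_wide _ _ rev _ (size_poly _ _)) horner_coef P_size.
  rewrite (reindex_inj rev_ord_inj); apply: eq_bigr => j _.
  by rewrite coef_poly ltn_ord !expr1n /= subSS subKn // -ltnS.
have P1 : P.[1] = (v n)%:R.
  by rewrite -[1](rmorph1 intr) horner_map /= Cyclotomic_at1.
have P1_neq0 : P.[1] != 0 by rewrite P1 pnatr_eq0 -lt0n v_gt0.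
have [z z_prim] := C_prim_root_exists n_gt0.
have zV_prim : n.-primitive_root z^-1.
  move: z_prim => /andP[_ /forallP z_prim]; apply/andP; split=> //.
  by apply/forallP => j; rewrite unity_rootE exprVn invr_eq1 -unity_rootE.
have : P %| rev.
  apply: (Cyclotomic_dvdp _ _ z) => //.
  have z_neq0 : z != 0.
    apply: contra_eqN (prim_expr_order z_prim) => /eqP->.
    by rewrite expr0n gtn_eqF // eq_sym oner_eq0.
  have := root_Cyclotomic _ _ _ zV_prim.
  have -> : map_poly intr 'Phi_n = map_poly ratr P :> {poly algC}.
    by rewrite -map_poly_comp; apply: eq_map_poly => c; rewrite /= ratr_int.
  rewrite /root !(@horner_coef_wide _ (totient n).+1) ?size_map_poly
    ?size_poly ?P_size //.
  move=> /eqP/(congr1 (fun y => z ^+ totient n * y)).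
  rewrite mulr0 mulr_sumr (reindex_inj rev_ord_inj) => sum0;
  rewrite -[X in _ == X]sum0.
  apply/eqP/eq_bigr => j _; rewrite !coef_map coef_poly ltn_ord /= subSS mulrCA.
  have j_le : (j <= totient n)%N by rewrite -ltnS.
  rewrite exprVn -exprB ?unitfE ?leq_subr // subKn //.
  by rewrite /P coef_map.
have rev_neq0 : rev != 0 by apply: contraNneq P1_neq0 => rev0;
rewrite -rev1 rev0 horner0.
move=> P_rev; have := dvdp_leq rev_neq0 P_rev.
have rev_size : (size rev <= size P)%N by rewrite P_size size_poly.
move=> P_size_le; move: (dvdp_size_eqp P_rev).
rewrite eqn_leq P_size_le rev_size => /esym/eqpP[[c d] /= /andP[c_neq0 d_neq0]
  cd].
have : c * P.[1] = d * rev.[1] by rewrite -!hornerZ cd.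
rewrite rev1 => /(mulIf P1_neq0) c_eq; rewrite -c_eq in cd.
have /(congr1 (fun p : {poly rat} => p`_i)) := scalerI c_neq0 cd.
rewrite [in RHS]coef_poly ltnS i_le [LHS]coef_map [RHS]coef_map.
exact: intr_inj.
Qed.

(** * From a primitive root of unity to the minimal polynomial of [4 sin(pi / n) ^ 2] *)

Lemma primitive_root_cos_sin (R : realType) (n : nat) : (0 < n)%N ->
  n.-primitive_root (cos (pi *+ 2 / n%:R) +i* sin (pi *+ 2 / n%:R) : R[i])%C.
Proof.
move=> n_gt0; set t : R := pi *+ 2 / n%:R.
have powE k : (cos t +i* sin t)%C ^+ k = (cos (t *+ k) +i* sin (t *+ k))%C :>
  R[i].
  elim: k => [|k IHk]; first by rewrite expr0 mulr0n cos0 sin0.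
  by rewrite exprS IHk mulrS cosD sinD; congr Complex; rewrite addrC.
have n_neq0 : n%:R != 0 :> R by rewrite pnatr_eq0 -lt0n.
apply/andP; split=> //; apply/forallP => -[k k_lt] /=.
rewrite unity_rootE powE -mulr_natr; apply/eqP.
have [->|k_neq] := eqVneq k.+1 n.
  by rewrite divfK // cos2pi sin2pi; exact: eqxx.
apply/negbTE/eqP => -[cos_eq _].
(* The exponent is [k.+1 < n], so [u] lies strictly between 0 and [pi]; but [cos (u *+ 2) = 1] would
   force [sin u = 0]. *)
pose u : R := pi * (k.+1%:R / n%:R).
have : 0 < sin u.
  apply: sin_gt0_pi; rewrite mulr_gt0 ?pi_gt0 ?divr_gt0 ?ltr0n //=.
  by rewrite gtr_pMr ?pi_gt0 // ltr_pdivrMr ?ltr0n // mul1r ltr_nat ltn_neqAle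
    k_neq.
have : cos (u *+ 2) = 1 by rewrite -cos_eq; congr cos; rewrite /u /t; field.
rewrite cos_mulr2n cos2sin2 => /eqP; rewrite -subr_eq0.
have -> : (1 - sin u ^+ 2) *+ 2 - 1 - 1 = - 2 * sin u ^+ 2 by ring.
by rewrite mulf_eq0 sqrf_eq0 oppr_eq0 pnatr_eq0 => /eqP ->; rewrite ltxx.
Qed.

(** For odd [d] this reads [p(-1) = - p(-1)]. Since ['Phi_(2 * n)] takes the positive value [v n] at
    -1, its degree must be even. *)
Lemma palindrome_atN1 (R : comNzRingType) (d : nat) (p : {poly R}) :
  (size p <= d.+1)%N -> (forall i, (i <= d)%N -> p`_i = p`_(d - i)) ->
  p.[-1] = (-1) ^+ d * p.[-1].
Proof.
move=> p_size pP; rewrite !(horner_coef_wide _ p_size) mulr_sumr.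
rewrite (reindex_inj rev_ord_inj); apply: eq_bigr => j _ /=.
have j_le : (j <= d)%N by rewrite -ltnS.
rewrite subSS -pP // mulrCA -exprD; congr (_ * _).
by rewrite -signr_odd oddB // -oddD signr_odd.
Qed.

Lemma Cyclotomic_double_symmetrize (n : nat) : (1 < n)%N ->
  exists k (psi : {poly int}), [/\ totient (2 * n) = (2 * k)%N,
    (size psi <= k.+1)%N & 'Phi_(2 * n) = symmetrize k psi].
Proof.
move=> n_gt1; have n2_gt1 : (1 < 2 * n)%N by rewrite (leq_trans n_gt1)
  ?leq_pmull.
have palP i := @Cyclotomic_palindrome _ i n2_gt1.
have P_size : (size 'Phi_(2 * n) <= (totient (2 * n)).+1)%N by rewrite
  size_Cyclotomic.
exists (totient (2 * n))./2.
have tE : totient (2 * n) = (2 * (totient (2 * n))./2)%N.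
  apply/esym/eqP; rewrite mul2n -{2}[totient _]odd_double_half -[X in X ==
    _]add0n.
  rewrite eqn_add2r eq_sym; case: (boolP (odd _)) => // odd_t.
  have := palindrome_atN1 _ _ _ P_size palP.
  rewrite -signr_odd odd_t Cyclotomic_double_atN1 // expr1 mulN1r => /eqP.
  by case: (v n) (v_gt0 n).
rewrite tE in P_size palP.
by have [psi psi_size ->] := palindrome_symmetrize _ _ P_size palP; exists psi.
Qed.

(** For [z] of argument [2 pi / n], [2 - z - z^-1 = 2 - 2 cos(2 pi / n) = 4 sin(pi / n) ^ 2], and
    the factor [z ^+ k] is nonzero. *)
Lemma root_symmetrize (R : realType) (n k : nat) (q : {poly rat}) :
  (0 < n)%N -> (size q <= k.+1)%N ->
  root (map_poly ratr (symmetrize k q))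
    (cos (pi *+ 2 / n%:R) +i* sin (pi *+ 2 / n%:R) : R[i])%C
  = root (map_poly ratr q) (4 * sin (pi / n%:R : R) ^+ 2).
Proof.
move=> n_gt0 q_size; set t : R := pi *+ 2 / n%:R; set z := (_ +i* _)%C.
set a : R := 4 * _.
have zV : z * (cos t -i* sin t)%C = 1.
  apply/eqP; rewrite eq_complex /=; apply/andP; split; apply/eqP; last by ring.
  by rewrite -(cos2Dsin2 t); ring.
have z_unit : z \is a GRing.unit by apply/unitrPr; eexists; exact: zV.
have aE : 2 - z - z^-1 = (a%:C)%C.
  rewrite (mulr1_eq zV); apply/eqP; rewrite eq_complex /=.
  have -> : t = (pi / n%:R) *+ 2 by rewrite /t mulrnAl.
  rewrite cos_mulr2n cos2sin2 /a; apply/andP; split; apply/eqP; ring.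
rewrite map_symmetrize /root horner_symmetrize ?size_map_poly // aE.
move: z_unit; rewrite unitfE mulf_eq0 expf_eq0 => /negPf ->; rewrite andbF /=.
have -> : map_poly ratr q = map_poly (real_complex R) (map_poly ratr q) :>
  {poly R[i]}.
  by rewrite -map_poly_comp; apply: eq_map_poly => c; rewrite /= fmorph_rat.
by rewrite horner_map fmorph_eq0.
Qed.

Lemma is_phi_symmetrize (R : realType) (n k : nat) (psi : {poly int}) :
  (1 < n)%N -> totient n = (2 * k)%N -> (size psi <= k.+1)%N ->
  'Phi_n = symmetrize k psi -> is_phi R n psi.
Proof.
move=> n_gt1 tn psi_size Pn; have n_gt0 := ltnW n_gt1.
(* ['Phi_n] is monic and palindromic, so its constant coefficient is 1; it is also [(-1) ^+ k] times
   the top coefficient of [psi]. *)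
have psi_k : psi`_k = (-1) ^+ k.
  have : ('Phi_n)`_0 = 1.
    rewrite Cyclotomic_palindrome // subn0.
    by rewrite -(monicP (Cyclotomic_monic n)) lead_coefE size_Cyclotomic.
  rewrite -horner_coef0 Pn symmetrize_at0 => /(congr1 ( *%R ((-1) ^+ k))).
  by rewrite mulrA -expr2 sqrr_sign mul1r mulr1.
have {}psi_size : size psi = k.+1.
  apply/eqP; rewrite eqn_leq psi_size ltnNge;
  apply: contra_eqN psi_k => /leq_sizeP.
  by move=> /(_ k (leqnn k)) ->; rewrite eq_sym signr_eq0.
set p : {poly rat} := map_poly intr psi.
have p_size : size p = k.+1 by rewrite size_map_inj_poly //; exact: intr_inj.
have p_neq0 : p != 0 by rewrite -size_poly_gt0 p_size.
set z : R[i] := (cos (pi *+ 2 / n%:R) +i* sin (pi *+ 2 / n%:R))%C.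
have z_prim : n.-primitive_root z by exact: primitive_root_cos_sin.
have PnQ : map_poly intr 'Phi_n = symmetrize k p by rewrite Pn map_symmetrize.
split; last first.
  rewrite -horner_coef0; have := @horner_symmetrize _ k psi 1.
  rewrite psi_size leqnn unitr1 -Pn Cyclotomic_at1 // expr1n mul1r invr1.
  have -> : 2 - 1 - 1 = 0 :> int by [].
  by move=> /(_ isT isT) <-; rewrite ltz_nat v_gt0.
exists ((-1) ^+ k *: p); last first.
  by rewrite -signr_odd; case: (odd k); [right|left];
  rewrite ?scaleN1r ?opprK ?scale1r.
split.
  rewrite monicE lead_coefZ lead_coefE p_size coef_map psi_k /=.
  by rewrite rmorph_sign -expr2 sqrr_sign.
move=> r; rewrite dvdpZl ?signr_eq0 //; set a := 4 * _.
have p_root : root (map_poly ratr p) a.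
  rewrite -(root_symmetrize R n k p) ?p_size // -PnQ -map_poly_comp.
  rewrite (eq_map_poly (_ : _ =1 intr)) ?root_Cyclotomic //.
  by move=> c; rewrite /= ratr_int.
apply/idP/idP => [r_root|/dvdpP[s ->]]; last first.
  by rewrite rmorphM rootM p_root orbT.
(* It suffices that [g] has full degree [k], for then it is associated to [p]. Symmetrizing [g] at
   its exact degree [(size g).-1] keeps the result nonzero, its value at 0 being the leading
   coefficient up to sign; divisibility by ['Phi_n], of degree [2 * k], then bounds this degree
   below by [k]. *)
set g := gcdp p r.
have g_root : root (map_poly ratr g) a by rewrite gcdp_map root_gcd p_root.
have g_neq0 : g != 0 by rewrite gcdp_eq0 (negPf p_neq0).
have g_size : size g = (size g).-1.+1 by rewrite prednK // size_poly_gt0.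
have g_dvd : map_poly intr 'Phi_n %| symmetrize (size g).-1 g.
  by apply: (Cyclotomic_dvdp _ _ z) => //; rewrite root_symmetrize // -g_size.
have sym_neq0 : symmetrize (size g).-1 g != 0.
  apply: contraNneq g_neq0 => /(congr1 (horner^~ 0)) /eqP.
  by rewrite symmetrize_at0 horner0 mulf_eq0 signr_eq0 -lead_coefE
    lead_coef_eq0.
have := leq_trans (dvdp_leq sym_neq0 g_dvd) (size_symmetrize _ _).
rewrite size_map_inj_poly ?size_Cyclotomic //; last exact: intr_inj.
rewrite ltnS tn leq_pmul2l // => k_le.
have : g %= p.
  rewrite -(dvdp_size_eqp (dvdp_gcdl p r)) eqn_leq dvdp_leq ?dvdp_gcdl //.
  by rewrite p_size g_size ltnS.
by rewrite eqp_sym => /eqp_dvdl ->; exact: dvdp_gcdr.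
Qed.

(** * The sign modulo 4 and the conclusion *)

Lemma dvdz_hornerB (p : {poly int}) (x y : int) : (x - y %| p.[x] - p.[y])%Z.
Proof.
have /factor_theorem[q pE] : root (p - (p.[y])%:P) y.
  by rewrite /root hornerD hornerN hornerC subrr.
have := congr1 (horner^~ x) pE.
rewrite hornerM !hornerD !hornerN hornerX !hornerC => ->.
by rewrite dvdz_mull.
Qed.

(** If [2 * n] is a prime power, it is a power of 2; then so is [n], and [1 < n] makes its exponent
    positive, whence [v n = 2]. *)
Lemma v_double (n : nat) : (1 < n)%N -> v n != 2%N -> v (2 * n) = 1%N.
Proof.
move=> n_gt1; apply: contraNeq => v_neq1.
have [/eqP|[v_pr [k k_gt0 nE]]] := vP (2 * n); first by rewrite (negPf v_neq1).
have : (2 %| v (2 * n) ^ k)%N by rewrite -nE dvdn_mulr.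
rewrite Euclid_dvdX // dvdn_prime2 // => /andP[/eqP v_eq _].
move: nE; rewrite -v_eq; case: k k_gt0 => // k _.
rewrite expnS => /eqP; rewrite eqn_pmul2l // => /eqP nE.
rewrite nE v_primeX //; case: k nE => // nE.
by rewrite nE in n_gt1.
Qed.

Theorem theorem2 (R : realType) (n : nat) (hn : (3 <= n)%N) :
  (((v n)%:Z = 1 %[mod 4])%Z \/ v n = 2%N ->
     (phi R (2 * n)).[4] = (v n)%:Z)
  /\
  (((v n)%:Z = -1 %[mod 4])%Z ->
     (phi R (2 * n)).[4] = - (v n)%:Z).
Proof.
have n_gt1 : (1 < n)%N by exact: ltnW.
have n2_gt1 : (1 < 2 * n)%N by rewrite (leq_trans n_gt1) ?leq_pmull.
have [k [psi [tn psi_size PE]]] := Cyclotomic_double_symmetrize _ n_gt1.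
have psi_phi := is_phi_symmetrize R _ _ _ n2_gt1 tn psi_size PE.
have -> : phi R (2 * n) = psi.
  by apply: (is_phi_unique _ psi_phi); exact: (@xgetI _ 0 [set p | is_phi R (2
    * n) p]%classic psi).
have psi4 : psi.[4] = (-1) ^+ k * (v n)%:Z.
  have /(congr1 ( *%R ((-1) ^+ k))) := horner_symmetrize _ _ _ psi_size
    (unitrN1 _).
  rewrite -PE Cyclotomic_double_atN1 // mulrA -expr2 sqrr_sign mul1r => ->.
  by congr (_.[_]).
have psi0 : psi.[0] = (v (2 * n))%:Z.
  have := horner_symmetrize _ _ _ psi_size (unitr1 _).
  by rewrite -PE Cyclotomic_at1 // expr1n mul1r invr1 => ->.
(* Integer coefficients give [psi.[4] = psi.[0]] modulo 4, and [psi.[0] = v (2 * n) = 1] here. *)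
have psi_mod4 : v n != 2%N -> ((-1) ^+ k * (v n)%:Z = 1 %[mod 4])%Z.
  move=> vn; apply/eqP; rewrite eqz_mod_dvd -psi4.
  by have := dvdz_hornerB psi 4 0; rewrite psi0 v_double // subr0.
rewrite psi4; split=> [[v1|v2]|vN1].
- have /psi_mod4 : v n != 2%N by apply: contra_eqN v1 => /eqP ->.
  rewrite -modzMmr v1 modzMmr mulr1 -signr_odd.
  by case: (odd k) => // _; rewrite mul1r.
(* Here [n = 2 ^ j], with [j >= 2] because [n >= 3]. From [2 * k = totient (2 ^ j.+1) = 2 ^ j]
   follows that [k = 2 ^ j.-1] is even. *)
- have [|[_ [j j_gt0 nE]]] := vP n; first by rewrite v2.
  move: tn; rewrite nE v2 -expnS totient_pfactor // mul1n /=.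
  case: j nE {j_gt0} => [|[|j]] nE; try by rewrite nE v2 in hn.
  rewrite expnS => /eqP; rewrite eqn_pmul2l // => /eqP <-.
  by rewrite -signr_odd oddX /= mul1r.
- have /psi_mod4 : v n != 2%N by apply: contra_eqN vN1 => /eqP ->.
  rewrite -modzMmr vN1 modzMmr -signr_odd.
  by case: (odd k) => // _; rewrite mulN1r.
Qed.
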